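(* Let $\mathcal C$ be a clutter on the vertex set $[n]=\{1,\ldots,n\}$. The following statements are equivalent: (i) $\mathcal C$ is a forest; (ii) $\mathcal C$ is totally balanced; (iii) $\mathcal C$ has the free vertex property.
   Context: A clutter $\mathcal C$ with vertex set $[n]$ is a family of (nonempty) subsets of $[n]$, called edges, none of which is contained in another. Its edge ideal, in $S=K[x_1,\ldots,x_n]$ with $K$ a field, is $I(\mathcal C)=(\prod_{i\in C}x_i : C \text{ an edge of }\mathcal C)$. Forest: let $\Delta$ be the simplicial complex whose facets are the edges of $\mathcal C$. A subcomplex of $\Delta$ here means a simplicial complex whose set of facets is a subset of the set of facets of $\Delta$. A facet $F$ of a simplicial complex is a leaf if either $F$ is its only facet, or there is a facet $G\ne F$ such that $F\cap H\subseteq F\cap G$ for every facet $H\neq F$. A simplicial complex is a tree if it is connected and every nonempty subcomplex of it has a leaf; it is a forest if every connected component is a tree. $\mathcal C$ is a forest if $\Delta$ is a forest. Totally balanced: if $C_1,\ldots,C_m$ are the edges of $\mathcal C$, the incidence matrix of $\mathcal C$ is the $n\times m$ matrix $(e_{ij})$ with $e_{ij}=1$ if $i\in C_j$ and $e_{ij}=0$ if $i\notin C_j$. $\mathcal C$ is called totally balanced if its incidence matrix has no square submatrix of order at least $3$ with exactly two 1's in each row and column. Free vertex property: for a monomial ideal $J$ with minimal monomial generating set $G(J)$, a variable is a free variable of $J$ if it divides exactly one element of $G(J)$. For disjoint subsets $X_1,X_2$ of $X=\{x_1,\ldots,x_n\}$, the minor $I_{(X_1,X_2)}\subset K[X\setminus(X_1\cup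 X_2)]$ of a monomial ideal $I\subset S$ is the ideal obtained from $I$ by setting all variables in $X_1$ equal to $0$ and all variables in $X_2$ equal to $1$. $\mathcal C$ has the free vertex property if every minor of $I(\mathcal C)$ (other than the zero ideal and the unit ideal) has a free variable.
   Formalization: In ''totally balanced'', the forbidden square submatrices of order at least 3 with exactly two 1's in each row and column are also required to have pairwise distinct columns; without this, the forest with edges 125, 126, 347, 348 would not be totally balanced. *)

(* Defs.v *)
From mathcomp Require Import all_boot all_algebra.
From mathcomp.multinomials Require Import mpoly.

Set Implicit Arguments.
Unset Strict Implicit.
Unset Printing Implicit Defensive.

Import GRing.Theory.

Local Open Scope ring_scope.

Definition clutter n (C : {set {set 'I_n}}) : Prop :=
  (set0 \notin C) /\
  (forall A B : {set 'I_n}, A \in C -> B \in C -> A \subset B -> A = B).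

(* A simplicial complex is given by its set of faces.  [set0] is the complex
   with no face at all, which is the one attached to the empty clutter. *)

Definition simplicial_complex (T : finType) (D : {set {set T}}) : Prop :=
  forall F F' : {set T}, F \in D -> F' \subset F -> F' \in D.

Definition facets (T : finType) (D : {set {set T}}) : {set {set T}} :=
  [set F | maxset (fun A : {set T} => A \in D) F].

Definition subcomplex (T : finType) (G D : {set {set T}}) : Prop :=
  simplicial_complex G /\ facets G \subset facets D.

Definition leaf (T : finType) (D : {set {set T}}) (F : {set T}) : Prop :=
  F \in facets D /\
  (facets D = [set F] \/
   exists G : {set T}, [/\ G \in facets D, G <> F &
     forall H : {set T}, H \in facets D -> H <> F -> F :&: H \subset F :&: G]).

(* Any two facets are joined by a chain of facets in which consecutive ones
   intersect. *)
Definition connected_complex (T : finType) (D : {set {set T}}) : Prop :=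
  forall F G : {set T}, F \in facets D -> G \in facets D ->
    connect (fun A B : {set T} =>
               [&& A \in facets D, B \in facets D & A :&: B != set0]) F G.

Definition connected_component (T : finType) (G D : {set {set T}}) : Prop :=
  [/\ subcomplex G D, G <> set0, connected_complex G &
      forall G' : {set {set T}}, subcomplex G' D -> connected_complex G' ->
        G \subset G' -> G' = G].

Definition tree_complex (T : finType) (D : {set {set T}}) : Prop :=
  connected_complex D /\
  (forall G : {set {set T}}, subcomplex G D -> G <> set0 ->
     exists F : {set T}, leaf G F).

Definition forest_complex (T : finType) (D : {set {set T}}) : Prop :=
  forall G : {set {set T}}, connected_component G D -> tree_complex G.

Definition clutter_complex n (C : {set {set 'I_n}}) : {set {set 'I_n}} :=
  [set F : {set 'I_n} | [exists E in C, F \subset E]].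

Definition forest n (C : {set {set 'I_n}}) : Prop :=
  forest_complex (clutter_complex C).

Definition incidence_matrix n (C : {set {set 'I_n}}) : 'M[nat]_(n, #|C|) :=
  \matrix_(i < n, j < #|C|) nat_of_bool (i \in (enum_val j : {set 'I_n})).

Definition two_ones_per_line k (M : 'M[nat]_k) : Prop :=
  (forall i : 'I_k, #|[set j | M i j == 1%N]| = 2) /\
  (forall j : 'I_k, #|[set i | M i j == 1%N]| = 2).

(* The forbidden submatrices are meant to be those of cycles of length at
   least 3, so two equal columns (a "2-cycle", i.e. an all-ones 2 x 2 block)
   must be excluded.  Without the last clause, the forest with edges
   {1,2,5}, {1,2,6}, {3,4,7}, {3,4,8} would fail to be totally balanced, as
   its rows 1, 2, 3, 4 consist of two diagonal all-ones 2 x 2 blocks. *)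
Definition totally_balanced n (C : {set {set 'I_n}}) : Prop :=
  ~ exists (k : nat) (f : 'I_k -> 'I_n) (g : 'I_k -> 'I_#|C|),
      let M := mxsub f g (incidence_matrix C) in
      [/\ (3 <= k)%N,
          {homo f : i j / (i < j)%N},
          {homo g : i j / (i < j)%N},
          two_ones_per_line M &
          injective (fun j : 'I_k => col j M)].

Definition gen_ideal (R : comNzRingType) (G : R -> Prop) : R -> Prop :=
  fun p => exists s : seq (R * R),
    (forall c, c \in s -> G c.2) /\ p = \sum_(c <- s) c.1 * c.2.

Definition edge_ideal (K : fieldType) n (C : {set {set 'I_n}}) :
    {mpoly K[n]} -> Prop :=
  gen_ideal (fun p => exists2 E : {set 'I_n}, E \in C & p = \prod_(i in E) 'X_i).

Arguments edge_ideal K {n} C _.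

(* The polynomial ring on the remaining variables [Y = ~: (X1 :|: X2)] is
   {mpoly K[#|Y|]}, its [j]-th variable being the variable [enum_val j] of Y;
   so the last branch below is reached exactly for [i \in X2]. *)
Definition minor_subst (K : fieldType) n (X1 X2 : {set 'I_n}) (i : 'I_n) :
    {mpoly K[#|~: (X1 :|: X2)|]} :=
  if i \in X1 then 0
  else if [pick j : 'I_#|~: (X1 :|: X2)| | enum_val j == i] is Some j
       then 'X_j else 1.

Definition minor (K : fieldType) n (I : {mpoly K[n]} -> Prop)
    (X1 X2 : {set 'I_n}) : {mpoly K[#|~: (X1 :|: X2)|]} -> Prop :=
  fun q => exists2 p : {mpoly K[n]}, I p &
    q = p \mPo [tuple minor_subst K X1 X2 i | i < n].

Arguments minor {K n} I X1 X2 _.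

Definition mon_generates (K : fieldType) n (G : 'X_{1..n} -> Prop)
    (J : {mpoly K[n]} -> Prop) : Prop :=
  forall p : {mpoly K[n]},
    J p <-> gen_ideal (fun q => exists2 u : 'X_{1..n}, G u & q = 'X_[u]) p.

Definition min_mon_gens (K : fieldType) n (G : 'X_{1..n} -> Prop)
    (J : {mpoly K[n]} -> Prop) : Prop :=
  mon_generates G J /\
  (forall G' : 'X_{1..n} -> Prop, (forall u, G' u -> G u) ->
     mon_generates G' J -> forall u, G u -> G' u).

(* [(U_(i) <= u)%MM] says that the variable [i] divides the monomial [u]. *)
Definition free_variable (K : fieldType) n (J : {mpoly K[n]} -> Prop)
    (i : 'I_n) : Prop :=
  exists2 G : 'X_{1..n} -> Prop, min_mon_gens G J &
    exists! u : 'X_{1..n}, G u /\ (U_(i) <= u)%MM.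

Definition free_vertex_property (K : fieldType) n (C : {set {set 'I_n}}) :
    Prop :=
  forall X1 X2 : {set 'I_n}, [disjoint X1 & X2] ->
    let J := minor (edge_ideal K C) X1 X2 in
    ~ (forall q, J q <-> q = 0) -> ~ J 1 ->
    exists i : 'I_#|~: (X1 :|: X2)|, free_variable J i.

(* Main.v *)
(** A submatrix forbidden by total balancedness amounts to a vertex set V and a
    nonempty edge family F such that every v in V lies in two edges of F, every
    edge of F meets V in two points, and distinct edges have distinct traces on
    V ([special] below); F then is a disjoint union of cycles of length >= 3.

    A leaf of the edges of F in one connected component would have the same
    trace as its branch, so forests have no special pair.  Conversely, enumerate
    the edges by Prim's algorithm, always adding an edge that has maximal
    intersection with an earlier one.  If the last edge L were not a leaf, with
    the earlier edge G of maximal |L :&: G| as branch, some v would lie in L and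
    in an earlier edge H, but not in G; the links of Prim's tree would join L to
    H through edges avoiding v, by intersections not contained in L :&: H, and a
    shortest such chain, closed up by v, is a special cycle.

    In a clutter a leaf has a free vertex, and special pairs of a minor lift to
    the clutter, so total balancedness gives the free vertex property.
    Conversely, take a special pair in a minor with as few vertices as possible:
    a free vertex v of this minor is not in V, and deleting or contracting v,
    according to whether its edge is outside or inside F, leaves a special pair
    in a smaller minor. *)

Require Import Defs.
From mathcomp Require Import all_boot all_algebra.
From mathcomp.multinomials Require Import mpoly.
From mathcomp Require Import zify.

Set Implicit Arguments.
Unset Strict Implicit.
Unset Printing Implicit Defensive.

Import GRing.Theory.

(** * Special pairs *)

Definition special (T : finType) (V : {set T}) (F : {set {set T}}) : Prop :=
  [/\ F != set0,
      forall v, v \in V -> #|[set e in F | v \in e]| = 2,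
      forall e : {set T}, e \in F -> #|e :&: V| = 2 &
      {in F &, injective (fun e : {set T} => e :&: V)}].

Definition no_special (T : finType) (C : {set {set T}}) : Prop :=
  forall (V : {set T}) (F : {set {set T}}), F \subset C -> ~ special V F.

(** Double counting of the incidences between [V] and [F]: each vertex and each edge takes part in
    two. The corresponding submatrix is thus square. *)
Lemma card_special (T : finType) (V : {set T}) (F : {set {set T}}) :
  special V F -> #|V| = #|F|.
Proof.
case=> _ Vdeg Fdeg _.
have : \sum_(v in V) #|[set e in F | v \in e]| = \sum_(e in F) #|e :&: V|.
  have -> : \sum_(v in V) #|[set e in F | v \in e]|
          = \sum_(v in V) \sum_(e in F) (v \in e).
    apply: eq_bigr => v _; rewrite -sum1_card [LHS]big_mkcond [RHS]big_mkcond /=.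
    by apply: eq_bigr => e _; rewrite inE; case: (e \in F); case: (v \in e).
  rewrite exchange_big /=; apply: eq_bigr => e _.
  rewrite -sum1_card [LHS]big_mkcond [RHS]big_mkcond /=.
  by apply: eq_bigr => v _; rewrite inE; case: (v \in V); case: (v \in e).
rewrite (eq_bigr (fun=> 2)) // [RHS](eq_bigr (fun=> 2)) // !sum_nat_const.
lia.
Qed.

(** If [V] had two elements, every trace would be [V] itself, so [F] would have a single edge,
    against [card_special]. *)
Lemma special_ge3 (T : finType) (V : {set T}) (F : {set {set T}}) :
  special V F -> 3 <= #|V|.
Proof.
move=> sVF; have cVF := card_special sVF; case: sVF => /set0Pn[e eF] _ Fdeg Finj.
have V2 : 2 <= #|V| by rewrite -(Fdeg e eF) subset_leq_card ?subsetIr.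
case: ltnP => // V3; have V2e : #|V| = 2 by lia.
have traceE f : f \in F -> f :&: V = V.
  by move=> fF; apply/eqP; rewrite eqEcard subsetIr (Fdeg f fF) V2e.
suff : #|F| <= 1 by lia.
by apply/card_le1_eqP => a b aF bF; apply: Finj; rewrite // !traceE.
Qed.

(* A chord of the chain Q 0, ..., Q r outside Q 0 :&: Q r gives a shorter chain;
   a chain without such chords is closed up by v to a special cycle. *)
Lemma path_special (T : finType) (C : {set {set T}}) (v : T) (r : nat)
    (Q : nat -> {set T}) :
    0 < r -> v \in Q 0 -> v \in Q r -> (forall i, i <= r -> Q i \in C) ->
    (forall i, 0 < i < r -> v \notin Q i) ->
    (forall i, i < r -> ~~ (Q i :&: Q i.+1 \subset Q 0 :&: Q r)) ->
  exists (V : {set T}) (F : {set {set T}}), F \subset C /\ special V F.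
Proof.
elim/ltn_ind: r Q => r IHr Q r0 v0 vr QC vQ stepQ.
case: (boolP [exists i : 'I_r.+1, exists j : 'I_r.+1,
   (i.+2 <= j) && ~~ (Q i :&: Q j \subset Q 0 :&: Q r)]).
  case/existsP=> -[i ltir] /existsP[[j ltjr]] /= /andP[ltij chord].
  (* The shortcut: [Q'] jumps from [Q i] to [Q j], since [i.+1 + d = j]. *)
  pose d := j - i.+1; pose Q' k := if k <= i then Q k else Q (k + d).
  have Q'0 : Q' 0 = Q 0 by [].
  have Q'r : Q' (r - d) = Q r.
    by rewrite /Q' /d; case: leqP => ?; [|congr Q]; lia.
  have [dr dr0] : r - d < r /\ 0 < r - d by rewrite /d; lia.
  apply: (IHr (r - d) dr Q'); rewrite ?Q'r ?Q'0 //.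
  - by move=> k kr; rewrite /Q'; case: ifP => ?; apply: QC; lia.
  - by move=> k kr; rewrite /Q'; case: ifP => ?; apply: vQ; lia.
  - move=> k kr; rewrite /Q'; case: (ltngtP k i) => ki.
    + by apply: stepQ; lia.
    + by rewrite addSn; apply: stepQ; lia.
    + by rewrite ki /d subnKC 1?ltnW.
move/existsPn=> chordless.
have {}chordless i j x : i.+2 <= j <= r -> x \in Q i -> x \in Q j ->
    x \in Q 0 :&: Q r.
  case/andP=> ij jr xi xj.
  have ltjr : j < r.+1 by []. have ltir : i < r.+1 by lia.
  have /existsPn/(_ (Ordinal ltjr)) /= := chordless (Ordinal ltir).
  by rewrite ij negbK => /subsetP; apply; rewrite inE xi.
have r2 : 2 <= r.
  rewrite ltn_neqAle r0 andbT; apply/eqP=> r1.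
  by have := stepQ 0 r0; rewrite -r1 subxx.
(* The i-th vertex of the cycle lies exactly in Q i.-1 and Q i, where w 0 = v lies
   in Q r and Q 0. *)
pose w i := if i == 0 then v else
  odflt v [pick x in Q i.-1 :&: Q i :\: (Q 0 :&: Q r)].
have wP i : 0 < i <= r ->
    [/\ w i \in Q i.-1, w i \in Q i & w i \notin Q 0 :&: Q r].
  case: i => // i /= lir; rewrite /w /=.
  case: pickP => [x|none]; first by rewrite inE [x \in _ :&: Q i.+1]inE => /and3P[].
  have /subsetPn[x xi xS] := stepQ i lir.
  by have := none x; rewrite inE xS xi.
(* Cyclic successor: among the vertices of the cycle, [Q j] will contain exactly [w j] and
   [w (sc j)]. *)
pose sc j := if j == r then 0 else j.+1.
have scr j : j <= r -> sc j <= r by rewrite /sc; case: eqP => //; lia.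
have wE i j : i <= r -> j <= r -> (w i \in Q j) = (i == j) || (i == sc j).
  move=> ir jr; rewrite /sc; case: (posnP i) => [->|i0].
    rewrite {1}/w eqxx; case: (posnP j) => [->|j0]; first by rewrite v0.
    case: (eqVneq j r) => [->|njr]; first by rewrite vr orbT.
    by rewrite (negbTE (vQ j _)); lia.
  have [wi1 wi wS] : [/\ w i \in Q i.-1, w i \in Q i & w i \notin Q 0 :&: Q r].
    by apply: wP; rewrite i0.
  case: (eqVneq i j) => [<-|nij]; first by rewrite wi.
  case: (eqVneq j i.-1) => [->|nji].
    by rewrite wi1; case: (eqVneq i.-1 r) => ?; apply/esym/eqP; lia.
  (* Otherwise [w i], lying in [Q i.-1] and [Q i], is common to two edges whose indices differ by at
     least 2, hence lies in [Q 0 :&: Q r], against its choice. *)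
  have -> : (w i \in Q j) = false.
    apply: contraNF wS => wj; case: (ltngtP i j) => ij; last by lia.
      by apply: (@chordless i.-1 j); rewrite // ; lia.
    by apply: (@chordless j i); rewrite //; lia.
  by case: (eqVneq j r) => ?; apply/esym/negbTE/eqP; lia.
(* As [r >= 2], the cycle has at least three vertices, so two distinct indices are never successors
   of each other. *)
have sc_loop i k : i <= r -> k <= r -> (k == i) || (k == sc i) ->
    (i == k) || (i == sc k) -> i = k.
  move=> ir kr /orP[/eqP//|/eqP ki] /orP[/eqP//|/eqP ik].
  by move: ki ik; rewrite /sc; case: (eqVneq i r); case: (eqVneq k r); lia.
have w_inj i k : i <= r -> k <= r -> w i = w k -> i = k.
  move=> ir kr wik; apply: sc_loop => //; rewrite -wE //.
    by rewrite -wik wE ?eqxx.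
  by rewrite wik wE ?eqxx.
have Q_inj j k : j <= r -> k <= r -> (forall i, i <= r ->
    (w i \in Q j) = (w i \in Q k)) -> j = k.
  move=> jr kr ejk; apply: sc_loop => //; rewrite -wE //.
    by rewrite ejk ?wE ?eqxx.
  by rewrite -ejk ?wE ?eqxx.
pose V := [set w (i : 'I_r.+1) | i in [set: 'I_r.+1]].
pose F := [set Q (j : 'I_r.+1) | j in [set: 'I_r.+1]].
have inV i : i <= r -> w i \in V.
  by move=> ir; apply/imsetP; exists (@Ordinal r.+1 i ir).
have inF i : i <= r -> Q i \in F.
  by move=> ir; apply/imsetP; exists (@Ordinal r.+1 i ir).
exists V, F; split; first by apply/subsetP=> _ /imsetP[j _ ->]; apply: QC; rewrite -ltnS.
split.
- by apply/set0Pn; exists (Q 0); apply: inF.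
- move=> _ /imsetP[[i /= ir] _ ->]; rewrite ltnS in ir.
  (* Cyclic predecessor: the edges through [w i] are [Q i] and [Q pr]. *)
  pose pr := if i == 0 then r else i.-1.
  have prr : pr <= r by rewrite /pr; case: (posnP i); lia.
  have scE j : j <= r -> (i == sc j) = (j == pr).
    rewrite /sc /pr => jr; case: (eqVneq j r) => [->|?]; case: (posnP i) => ?.
    - by rewrite eqxx; apply/eqP.
    - by apply/eqP/eqP; lia.
    - by apply/eqP/eqP; lia.
    - by apply/eqP/eqP; lia.
  have -> : [set e in F | w i \in e] = [set Q i; Q pr].
    apply/setP=> e; rewrite !inE; apply/andP/orP.
      case=> /imsetP[[j /= jr] _ ->]; rewrite ltnS in jr; rewrite wE //.
      by rewrite scE // => /orP[]/eqP->; rewrite eqxx; [left|right].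
    by case=> /eqP->; (split; first exact: inF); rewrite wE // ?scE // eqxx ?orbT.
  rewrite cards2; case: eqP => // eQ.
  have : i = pr by apply: Q_inj => // k _; rewrite eQ.
  by rewrite /pr; case: (posnP i); lia.
- move=> _ /imsetP[[j /= jr] _ ->]; rewrite ltnS in jr.
  have -> : Q j :&: V = [set w j; w (sc j)].
    apply/setP=> x; rewrite !inE; apply/andP/orP.
      case=> + /imsetP[[i /= ir] _ ex]; rewrite ltnS in ir.
      by rewrite ex wE // => /orP[]/eqP->; [left|right].
    by case=> /eqP->; (split; last by apply: inV; rewrite ?scr); rewrite wE ?scr ?eqxx ?orbT.
  rewrite cards2; case: eqP => // /w_inj; rewrite scr // => /(_ jr isT).
  by rewrite /sc; case: eqP; lia.
- move=> _ _ /imsetP[[j /= jr] _ ->] /imsetP[[k /= kr] _ ->] ejk.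
  congr Q; apply: Q_inj => // i ir; move/setP/(_ (w i)): ejk.
  by rewrite !inE inV // !andbT.
Qed.

(** * Leaves from Prim's algorithm *)

(** The leaf condition on a bare family of edges; [leaf D] is [leaf_in (facets D)]. *)
Definition leaf_in (T : finType) (C : {set {set T}}) (L : {set T}) : Prop :=
  L \in C /\
  (C = [set L] \/
   exists G : {set T}, [/\ G \in C, G <> L &
     forall H : {set T}, H \in C -> H <> L -> L :&: H \subset L :&: G]).

(** Adjacency in the intersection graph of [C], weighted by the sizes of intersections and cut at
    weight [t]. *)
Definition linked (T : finType) (C : {set {set T}}) (t : nat) : rel {set T} :=
  fun A B => [&& A \in C, B \in C & t <= #|A :&: B|].

(* The invariant of Prim's algorithm: a maximum spanning tree of [A] is part of one
   of [C], expressed by connectivity at every threshold instead of by trees. *)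
Definition inherits_links (T : finType) (C A : {set {set T}}) : Prop :=
  forall t G H, G \in A -> H \in A ->
    connect (linked C t) G H -> connect (linked A t) G H.

Lemma linked_sym (T : finType) (C : {set {set T}}) (t : nat) :
  ssrbool.symmetric (linked C t).
Proof. by move=> A B; rewrite /linked setIC andbCA. Qed.

Lemma connect_crossing (T : finType) (e : rel T) (A : {pred T}) (x y : T) :
    connect e x y -> x \notin A -> y \in A ->
  exists x' y', [/\ x' \notin A, y' \in A & e x' y'].
Proof.
case/connectP=> p; elim: p x => [|z p IHp] x /=; first by move=> _ -> /negP.
case/andP=> exz pth yE xA yA; case: (boolP (z \in A)) => zA.
  by exists x, z.
exact: (IHp z).
Qed.

Lemma linked_mono (T : finType) (A B : {set {set T}}) (t u : nat) :
  A \subset B -> u <= t -> subrel (linked A t) (linked B u).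
Proof.
move=> /subsetP sAB ut P Q /and3P[PA QA tPQ].
by rewrite /linked !sAB // (leq_trans ut tPQ).
Qed.

(** One step of Prim's algorithm: [M] outside [A] and [G0] in [A] have the largest intersection. A
    chain at threshold [t] from [M] into [A] enters [A] by an intersection of size at least [t], so
    [M] and [G0] are linked at [t] as well. *)
Lemma inherits_links_extend (T : finType) (C A : {set {set T}}) :
    A != set0 -> A \proper C -> inherits_links C A ->
  exists M, [/\ M \in C, M \notin A & inherits_links C (M |: A)].
Proof.
case/set0Pn=> G1 G1A /properP[sAC [L1 L1C L1A]] lnkA.
have P1 : (L1, G1).1 \in C :\: A /\ (L1, G1).2 \in A by rewrite inE L1A.
case: (@arg_maxnP _ (L1, G1) (fun p => (p.1 \in C :\: A) && (p.2 \in A))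
         (fun p => #|p.1 :&: p.2|)) => [|[M G0] /= /andP[MCA G0A] Mmax].
  by case: P1 => -> ->.
have [MA MC] : M \notin A /\ M \in C by move: MCA; rewrite inE => /andP.
exists M; split=> //.
have sA' : A \subset M |: A by apply: subsetUr.
have G0C := subsetP sAC _ G0A.
have linkM t G : G \in A -> connect (linked C t) M G ->
    connect (linked (M |: A) t) M G.
  move=> GA cMG; have [L [H [LA HA]]] := connect_crossing cMG MA GA.
  case/and3P=> LC HC tLH.
  have tMG : t <= #|M :&: G0|.
    by apply: leq_trans tLH (Mmax (L, H) _); rewrite /= inE LA LC.
  apply: (connect_trans (y := G0)).
    by apply: connect1; rewrite /linked !inE eqxx G0A orbT.
  apply: (connect_sub (e := linked A t)).
    by move=> P Q lPQ; apply: connect1; apply: linked_mono lPQ.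
  (* In [C], the edges [G0] and [G] are joined through [M]. *)
  apply: lnkA => //; apply: connect_trans cMG; apply: connect1.
  by rewrite /linked G0C MC setIC.
move=> t G H; rewrite !inE => /predU1P[->|GA] /predU1P[->|HA] cGH //.
- exact: linkM.
- rewrite sym_connect_sym; last exact: linked_sym.
  by apply: linkM; rewrite // sym_connect_sym //; apply: linked_sym.
- apply: (connect_sub (e := linked A t)); last exact: lnkA.
  by move=> P Q lPQ; apply: connect1; apply: linked_mono lPQ.
Qed.

(** Prim's algorithm is run from one edge, by induction on the number [k] of edges not yet reached;
    [L] is the edge added last. *)
Lemma exists_last_edge (T : finType) (C : {set {set T}}) : 1 < #|C| ->
  exists L, [/\ L \in C, C :\ L != set0 & inherits_links C (C :\ L)].
Proof.
move=> C1; have /card_gt0P[E0 E0C] : 0 < #|C| by lia.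
suff main k (A : {set {set T}}) : A != set0 -> A \proper C ->
    inherits_links C A -> #|C :\: A| = k ->
    exists L, [/\ L \in C, C :\ L != set0 & inherits_links C (C :\ L)].
  apply: (main _ [set E0]) => //; first by apply/set0Pn; exists E0; rewrite inE.
    by rewrite properEcard sub1set E0C cards1.
  by move=> t G H /set1P -> /set1P ->.
elim: k A => [|k IHk] A A0 prA lnkA cardA.
  have := proper_card prA; have := cardsID A C.
  by rewrite (setIidPr (proper_sub prA)); lia.
have [M [MC MA lnkM]] := inherits_links_extend A0 prA lnkA.
have sMA : M |: A \subset C by rewrite subUset sub1set MC proper_sub.
case: (eqVproper sMA) => [eMA|pMA].
  exists M; suff -> : C :\ M = A by [].
  by rewrite -eMA setU1K.
apply: (IHk (M |: A)) => //; first by apply/set0Pn; exists M; rewrite setU11.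
have := cardsD1 M (C :\: A); rewrite !inE MA MC cardA /= add1n => -[->].
by rewrite setDDl setUC.
Qed.

Lemma no_special_leaf (T : finType) (C : {set {set T}}) :
  C != set0 -> no_special C -> exists L, leaf_in C L.
Proof.
case/set0Pn=> E0 E0C nsC; case: (leqP #|C| 1) => C1.
  exists E0; split=> //; left; apply/eqP; rewrite eq_sym eqEcard sub1set E0C.
  by rewrite cards1.
have [L [LC /set0Pn[G1 G1A] lnk]] := exists_last_edge C1.
exists L; split=> //; right.
case: (@arg_maxnP _ G1 (fun G => G \in C :\ L) (fun G => #|L :&: G|) G1A)
  => G GA Gmax.
have [GL GC] : G != L /\ G \in C by move: (GA); rewrite !inE => /andP.
exists G; split=> //; first exact/eqP.
move=> H' H'C /eqP H'L; apply/subsetP=> v /setIP[vL vH'].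
rewrite inE vL /=; apply/negPn/negP => vG.
have H'A : (H' \in C :\ L) && (v \in H') by rewrite !inE H'L H'C.
case: (@arg_maxnP _ H' (fun G => (G \in C :\ L) && (v \in G))
         (fun G => #|L :&: G|) H'A) => H /andP[HA vH] Hmax.
(* By the choice of H, every earlier edge X containing v has |L :&: X| <= t. *)
pose t := #|L :&: H|.
have HC : H \in C by move: HA; rewrite inE => /andP[].
(* In [C] the edges [G] and [H] are joined through [L], as [L :&: G] has at least [t] elements; the
   invariant turns this into a chain avoiding [L]. *)
have : connect (linked (C :\ L) t) G H.
  apply: lnk => //; apply: (connect_trans (y := L)); apply: connect1.
    by rewrite /linked GC LC setIC; apply: Gmax.
  by rewrite /linked LC HC leqnn.
case/connectP=> p pthp eH.
have hasv : has (fun X : {set T} => v \in X) (G :: p).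
  by apply/hasP; exists H => //; rewrite eH mem_last.
(* The chain is cut at its first edge through [v], possibly before [H], so that the inner edges
   avoid [v]; [L] is put in front as [Q 0]. *)
pose i := find (fun X : {set T} => v \in X) (G :: p).
pose Q := nth L (L :: G :: p).
have isz : i < (size p).+1 by move: hasv; rewrite has_find.
have vQ k : k < i -> v \notin Q k.+1.
  by move=> ki; apply/negbT; apply: (before_find L ki).
have vQi : v \in Q i.+1 by apply: (nth_find L hasv).
have QA k : k <= size p -> Q k.+1 \in C :\ L.
  case: k => [|k] kp //=.
  have /(pathP L) /(_ k kp) := pthp.
  by rewrite /linked => /and3P[_ + _].
have Qt k : 0 < k <= size p -> t <= #|Q k :&: Q k.+1|.
  case: k => [|k] //= kp.
  by have /(pathP L)/(_ k kp)/and3P[_ _] := pthp.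
have small : #|Q 0 :&: Q i.+1| <= t.
  by apply: Hmax; rewrite QA.
have [||||||V [F [sFC spF]]] := @path_special T C v i.+1 Q; rewrite //.
- by case=> [|k] // ki; have /setD1P[] := QA k (leq_trans ki isz).
- by case=> [|k] // ki; apply: vQ.
(* Consecutive edges share at least [t] elements, none of them [v], whereas [Q 0 :&: Q i.+1]
   contains [v] and has at most [t] elements. *)
- move=> k ki; apply/negP=> sub.
  suff : t < t by rewrite ltnn.
  apply: (@leq_ltn_trans #|Q k :&: Q k.+1|).
    case: k ki {sub} => [|k] ki; first exact: Gmax.
    by apply: Qt; apply: leq_trans ki isz.
  apply: leq_trans small; apply: proper_card; rewrite properE sub.
  apply/subsetPn; exists v; first by rewrite inE vL.
  rewrite inE; case: k ki {sub} => [|k] ki; first by rewrite (negbTE vG) andbF.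
  by rewrite (negbTE (vQ k _)).
exact: nsC sFC spF.
Qed.

(** * Total balancedness and forests *)

Lemma no_specialS (T : finType) (C D : {set {set T}}) :
  C \subset D -> no_special D -> no_special C.
Proof. by move=> sCD nsD V F sFC; apply: nsD; apply: subset_trans sCD. Qed.

Lemma card_edges_at (I T : finType) (Q : I -> {set T}) (x : T) : injective Q ->
  #|[set e in [set Q j | j in [set: I]] | x \in e]| = #|[set j | x \in Q j]|.
Proof.
move=> Qinj; rewrite -(card_imset _ Qinj); congr #|pred_of_set _|.
apply/setP=> e; rewrite inE; apply/andP/imsetP.
  by case=> /imsetP[j _ ->] xj; exists j; rewrite ?inE.
by case=> j; rewrite inE => xj ->; rewrite imset_f.
Qed.

Lemma card_trace (I T : finType) (w : I -> T) (e : {set T}) : injective w ->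
  #|e :&: [set w i | i in [set: I]]| = #|[set i | w i \in e]|.
Proof.
move=> winj; rewrite -(card_imset _ winj); congr #|pred_of_set _|.
apply/setP=> x; rewrite inE; apply/andP/imsetP.
  by case=> xe /imsetP[i _ xi]; exists i; rewrite ?inE -?xi.
by case=> i; rewrite inE => ie ->; rewrite ie imset_f.
Qed.

(** [enum W] is a subsequence of the increasing enumeration of ['I_m]. It supplies the increasing
    row and column choices required of a submatrix. *)
Lemma enum_val_homo_ltn (m : nat) (W : {set 'I_m}) :
  {homo (@enum_val 'I_m (mem W)) : i j / (i < j)%N}.
Proof.
move=> i j ltij.
have srt : sorted (relpre val ltn) (enum W).
  rewrite {1}/enum_mem; apply: sorted_filter; first by move=> ? ? ?; apply: ltn_trans.
  by rewrite -enumT -sorted_map val_enum_ord iota_ltn_sorted.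
rewrite /enum_val (set_nth_default (enum_default j)) -?cardE //.
by apply: (sorted_ltn_nth _ _ srt); rewrite ?inE -?cardE // => ? ? ?; apply: ltn_trans.
Qed.

Lemma homo_ltn_inj (k m : nat) (h : 'I_k -> 'I_m) :
  {homo h : i j / (i < j)%N} -> injective h.
Proof.
by move=> hh i j hij; apply: val_inj; case: (ltngtP i j) => // /hh; rewrite hij ltnn.
Qed.

Lemma incidence_two_ones n (C : {set {set 'I_n}}) k (f : 'I_k -> 'I_n)
    (g : 'I_k -> 'I_#|C|) (Q := fun j => enum_val (g j) : {set 'I_n}) :
    injective f -> injective g ->
    two_ones_per_line (mxsub f g (incidence_matrix C)) <->
  (forall v, v \in [set f i | i in [set: 'I_k]] ->
     #|[set e in [set Q j | j in [set: 'I_k]] | v \in e]| = 2) /\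
  (forall e : {set 'I_n}, e \in [set Q j | j in [set: 'I_k]] ->
     #|e :&: [set f i | i in [set: 'I_k]]| = 2).
Proof.
move=> finj ginj; have Qinj : injective Q by move=> i j /enum_val_inj/ginj.
have rowE i : [set j | mxsub f g (incidence_matrix C) i j == 1%N]
            = [set j | f i \in Q j].
  by apply/setP=> j; rewrite !inE !mxE eqb1.
have colE j : [set i | mxsub f g (incidence_matrix C) i j == 1%N]
            = [set i | f i \in Q j].
  by apply/setP=> i; rewrite !inE !mxE eqb1.
split=> -[h1 h2]; split.
- by move=> _ /imsetP[i _ ->]; rewrite card_edges_at // -rowE.
- by move=> _ /imsetP[j _ ->]; rewrite card_trace // -colE.
- by move=> i; rewrite rowE -card_edges_at // h1 ?imset_f.
- by move=> j; rewrite colE -card_trace // h2 ?imset_f.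
Qed.

(** The rows are [V] and the columns are [F], equal in number by [card_special]; distinct columns
    amount to distinct traces on [V]. *)
Lemma totally_balancedP n (C : {set {set 'I_n}}) :
  totally_balanced C <-> no_special C.
Proof.
split=> [tbC V F sFC sVF|nsC [k [f [g [k3 fh gh]]]]].
  pose J := [set j : 'I_#|C| | (enum_val j : {set 'I_n}) \in F].
  have FE : F = [set enum_val j | j in J].
    apply/setP=> e; apply/idP/imsetP => [eF|[j jJ ->]]; last by rewrite inE in jJ.
    exists (enum_rank_in (subsetP sFC _ eF) e); last by rewrite enum_rankK_in ?(subsetP sFC).
    by rewrite inE enum_rankK_in ?(subsetP sFC).
  have cJ : #|V| = #|J|.
    by rewrite (card_special sVF) FE card_imset //; apply: enum_val_inj.
  pose f : 'I_#|V| -> 'I_n := enum_val.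
  pose g (i : 'I_#|V|) : 'I_#|C| := enum_val (cast_ord cJ i).
  have fh : {homo f : i j / (i < j)%N} by apply: enum_val_homo_ltn.
  have gh : {homo g : i j / (i < j)%N}.
    by move=> i j ij; apply: enum_val_homo_ltn.
  have VE : [set f i | i in [set: 'I_#|V|]] = V.
    apply/setP=> x; apply/imsetP/idP => [[i _ ->]|xV]; first exact: enum_valP.
    by exists (enum_rank_in xV x); rewrite /f ?enum_rankK_in.
  have QE : [set (enum_val (g j) : {set 'I_n}) | j in [set: 'I_#|V|]] = F.
    rewrite FE; apply/setP=> e; apply/imsetP/imsetP => -[j jJ ->].
      by exists (g j); rewrite ?enum_valP.
    exists (cast_ord (esym cJ) (enum_rank_in jJ j)) => //.
    by rewrite /g cast_ordKV enum_rankK_in.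
  apply: tbC; exists #|V|, f, g; split=> //; first exact: special_ge3 sVF.
    apply/(incidence_two_ones (homo_ltn_inj fh) (homo_ltn_inj gh)).
    by rewrite VE QE; case: sVF.
  case: sVF => _ _ _ Finj i j /colP eij.
  have gF i' : (enum_val (g i') : {set 'I_n}) \in F by rewrite -QE; apply/imsetP; exists i'.
  apply: (homo_ltn_inj gh); apply: enum_val_inj; apply: Finj => //.
  rewrite -VE; apply/setP=> x; rewrite !inE.
  case: imsetP => [[i' _ ->]|_]; last by rewrite !andbF.
  have := eij i'; rewrite !mxE !andbT.
  by case: (f i' \in _); case: (f i' \in _).
move=> /(incidence_two_ones (homo_ltn_inj fh) (homo_ltn_inj gh)) [Vdeg Fdeg] Minj.
apply: nsC (And4 _ Vdeg Fdeg _).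
- by apply/subsetP=> _ /imsetP[j _ ->]; apply: enum_valP.
- have k0 : 0 < k by apply: leq_trans k3.
  apply/set0Pn; exists (enum_val (g (Ordinal k0))).
  by apply/imsetP; exists (Ordinal k0).
- move=> _ _ /imsetP[i _ ->] /imsetP[j _ ->] eij; congr enum_val; congr g.
  apply: Minj; apply/colP=> i'; rewrite !mxE.
  by move/setP/(_ (f i')): eij; rewrite !inE imset_f // !andbT => ->.
Qed.

(** * The complex of a clutter and its connected components *)

Definition antichain (T : finType) (C : {set {set T}}) : Prop :=
  forall A B : {set T}, A \in C -> B \in C -> A \subset B -> A = B.

Lemma facets_clutter_complex n (C : {set {set 'I_n}}) :
  antichain C -> facets (clutter_complex C) = C.
Proof.
move=> acC; apply/setP=> F; rewrite inE; apply/maxsetP/idP => [[]|FC].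
  rewrite inE => /exists_inP[E EC FE] Fmax.
  by rewrite -(Fmax E) // inE; apply/exists_inP; exists E.
split; first by rewrite inE; apply/exists_inP; exists F.
move=> B; rewrite inE => /exists_inP[E EC BE] FB; apply/eqP.
by rewrite eqEsubset FB (acC F E FC EC (subset_trans FB BE)) BE.
Qed.

Lemma sub_facet (T : finType) (D : {set {set T}}) (F : {set T}) :
  F \in D -> exists2 E, E \in facets D & F \subset E.
Proof.
by move=> FD; have [E maxE FE] := maxset_exists FD; exists E; rewrite // inE.
Qed.

Lemma clutter_complex_simplicial n (C : {set {set 'I_n}}) :
  simplicial_complex (clutter_complex C).
Proof.
move=> F F'; rewrite !inE => /exists_inP[E EC FE] F'F.
by apply/exists_inP; exists E; rewrite ?(subset_trans F'F).
Qed.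

(** The facets of a subcomplex of a component are edges of [C], so they contain no special pair and
    [no_special_leaf] applies to them. *)
Lemma no_special_forest n (C : {set {set 'I_n}}) :
  clutter C -> no_special C -> forest C.
Proof.
move=> [_ acC] nsC G [[_ sGC] G0 cG _]; split=> // G' [_ sG'G] /eqP/set0Pn[F FG'].
apply: no_special_leaf.
  by have [E EG' _] := sub_facet FG'; apply/set0Pn; exists E.
apply: no_specialS nsC; apply: subset_trans sG'G _.
by move: sGC; rewrite facets_clutter_complex.
Qed.

(** For maximality: in a larger connected subcomplex [G'], the edge [E0] is still a facet by the
    antichain condition, and chains of facets of [G'] are chains of edges of [C]. *)
Lemma clutter_complex_component n (C : {set {set 'I_n}}) (E0 : {set 'I_n})
    (adj := fun A B : {set 'I_n} => [&& A \in C, B \in C & A :&: B != set0]) :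
    clutter C -> E0 \in C ->
  connected_component (clutter_complex [set E in C | connect adj E0 E])
                      (clutter_complex C).
Proof.
move=> [_ acC] E0C; set A := [set E in C | _].
have adj_sym : connect_sym adj.
  by apply: sym_connect_sym => X Y; rewrite /adj setIC andbCA.
have sAC : A \subset C by apply/subsetP=> E; rewrite inE => /andP[].
have acA : antichain A by move=> X Y /(subsetP sAC) ? /(subsetP sAC); apply: acC.
have E0A : E0 \in A by rewrite inE E0C connect0.
split.
- split; first exact: clutter_complex_simplicial.
  by rewrite !facets_clutter_complex.
- apply/eqP/set0Pn; exists E0; rewrite inE.
  by apply/exists_inP; exists E0.
- move=> F G; rewrite facets_clutter_complex // => FA GA.
  have : connect adj F G.
    apply: (connect_trans (y := E0)).
      by rewrite adj_sym; move: FA; rewrite inE => /andP[].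
    by move: GA; rewrite inE => /andP[].
  case/connectP=> p; elim: p F FA => [|X p IHp] F FA /= pth eG.
    by rewrite eG connect0.
  case/andP: pth => FX pth.
  have XA : X \in A.
    case/and3P: (FX) => FC XC _; rewrite inE XC.
    move: FA; rewrite inE => /andP[_ E0F]; apply: connect_trans E0F _.
    exact: connect1.
  apply: (connect_trans (y := X)); last exact: IHp.
  by apply: connect1; rewrite FA XA; case/and3P: FX.
- move=> G' [simG' sG'C] cG' sAG'; apply/eqP; rewrite eqEsubset sAG' andbT.
  rewrite facets_clutter_complex // in sG'C.
  have E0G' : E0 \in facets G'.
    have /(subsetP sAG') : E0 \in clutter_complex A.
      by rewrite inE; apply/exists_inP; exists E0.
    case/sub_facet=> E EG' sE0E.
    by rewrite (acC E0 E) // (subsetP sG'C).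
  apply/subsetP=> F /sub_facet[E EG' FE]; rewrite inE.
  apply/exists_inP; exists E => //; rewrite inE (subsetP sG'C) //=.
  apply: connect_sub (cG' _ _ E0G' EG') => X Y /and3P[XG' YG' XY].
  by apply: connect1; rewrite /adj XY !(subsetP sG'C).
Qed.

(** Each vertex of [V] on [L] lies in a second edge [H] of [B], hence in the branch [G]. Then [G]
    and [L] have the same trace, against injectivity. *)
Lemma special_no_leaf (T : finType) (V : {set T}) (F B : {set {set T}}) :
    special V F -> B \subset F ->
    (forall X Y, X \in B -> Y \in F -> X :&: Y != set0 -> Y \in B) ->
  forall L, ~ leaf_in B L.
Proof.
move=> [_ Vdeg Fdeg Finj] /subsetP sBF closB L [LB leafL].
have LF := sBF L LB.
have other v : v \in L :&: V -> exists H, [/\ H \in B, H <> L & v \in H].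
  case/setIP=> vL /Vdeg/eqP/cards2P[X [Y [nXY eXY]]].
  have /setIdP[XF vX] : X \in [set e in F | v \in e] by rewrite eXY set21.
  have /setIdP[YF vY] : Y \in [set e in F | v \in e] by rewrite eXY set22.
  have inB Z : Z \in F -> v \in Z -> Z \in B.
    move=> ZF vZ; apply: (closB L) => //.
    by apply/set0Pn; exists v; rewrite inE vL.
  case: (eqVneq X L) => XL; last by exists X; split; [exact: inB|exact/eqP|].
  by exists Y; split; [exact: inB|rewrite -XL; apply/eqP; rewrite eq_sym|].
have /set0Pn[v vLV] : L :&: V != set0 by rewrite -card_gt0 Fdeg.
case: leafL => [BL|[G [GB nGL Lmax]]].
  by have [H [HB nHL _]] := other v vLV; move: HB; rewrite BL inE => /eqP.
have GF := sBF G GB.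
apply: nGL; apply: Finj => //; apply/eqP; rewrite eq_sym eqEcard.
rewrite !Fdeg // leqnn andbT; apply/subsetP=> x xLV.
have [H [HB nHL xH]] := other x xLV; case/setIP: xLV => xL xV.
have /subsetP/(_ x) := Lmax H HB nHL.
by rewrite !inE xL xH xV /= => /(_ isT) ->.
Qed.

(** The edges of [F] in the component of one of them span a subcomplex of a tree, which has a leaf;
    this family absorbs every edge of [F] that meets it. *)
Lemma forest_no_special n (C : {set {set 'I_n}}) :
  clutter C -> forest C -> no_special C.
Proof.
move=> clC forC V F sFC sVF.
have [_ acC] := clC; have /set0Pn[E0 E0F] : F != set0 by case: sVF.
have E0C := subsetP sFC _ E0F.
have compG := clutter_complex_component clC E0C.
move: compG (forC _ compG); set A := [set E in C | _] => compG [_ treeG].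
have sAC : A \subset C by apply/subsetP=> E; rewrite inE => /andP[].
have acS (B : {set {set 'I_n}}) : B \subset C -> antichain B.
  by move=> /subsetP sBC X Y /sBC ? /sBC; apply: acC.
pose B := F :&: A.
have sBC : B \subset C by apply: subset_trans sFC; apply: subsetIl.
have E0A : E0 \in A by rewrite inE E0C connect0.
have [L leafL] : exists L, leaf (clutter_complex B) L.
  apply: treeG.
    split; first exact: clutter_complex_simplicial.
    rewrite !facets_clutter_complex ?subsetIr //; exact: acS.
  apply/eqP/set0Pn; exists E0; rewrite inE; apply/exists_inP; exists E0 => //.
  by rewrite inE E0F.
apply: (special_no_leaf sVF (subsetIl F A) _ (L := L)); last first.
  by move: leafL; rewrite /leaf facets_clutter_complex //; apply: acS.
move=> X Y /setIP[XF XA] YF XY; rewrite inE YF inE (subsetP sFC) //=.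
move: XA; rewrite inE => /andP[XC E0X]; apply: connect_trans E0X _.
by apply: connect1; rewrite XC XY (subsetP sFC).
Qed.

(** * Minors of clutters *)

Lemma disjoint_setU1 (T : finType) (x : T) (A B : {set T}) :
  [disjoint x |: A & B] = (x \notin B) && [disjoint A & B].
Proof. by rewrite !disjoints_subset subUset sub1set inE. Qed.

(* Only the inclusion-minimal members are edges of the minor. *)
Definition minor_edges (T : finType) (C : {set {set T}}) (X1 X2 : {set T}) :
    {set {set T}} :=
  [set E :\: X2 | E in [set E in C | [disjoint E & X1]]].

Definition minimal_sets (T : finType) (A : {set {set T}}) : {set {set T}} :=
  [set E | minset (fun B : {set T} => B \in A) E].

Lemma minimal_setsP (T : finType) (A : {set {set T}}) (E : {set T}) :
  reflect (E \in A /\ forall B, B \in A -> B \subset E -> B = E)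
          (E \in minimal_sets A).
Proof. by rewrite inE; apply: minsetP. Qed.

Lemma minimal_sub (T : finType) (A : {set {set T}}) : minimal_sets A \subset A.
Proof. by apply/subsetP=> E /minimal_setsP[]. Qed.

Lemma minimal_exists (T : finType) (A : {set {set T}}) (E : {set T}) :
  E \in A -> exists2 B, B \in minimal_sets A & B \subset E.
Proof.
by move=> EA; have [B minB BE] := @minset_exists _ (fun B => B \in A) _ EA;
   exists B; rewrite // inE.
Qed.

Lemma minor_edgesP (T : finType) (C : {set {set T}}) (X1 X2 e : {set T}) :
  reflect (exists E, [/\ E \in C, [disjoint E & X1] & e = E :\: X2])
          (e \in minor_edges C X1 X2).
Proof.
apply: (iffP imsetP) => [[E /setIdP[EC EX1] ->]|[E [EC EX1 ->]]].
  by exists E.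
by exists E => //; apply/setIdP.
Qed.

(** Being special depends only on the traces on [V], which also force [phi] to be injective on
    [F]. *)
Lemma special_transport (T : finType) (V : {set T}) (F : {set {set T}})
    (phi : {set T} -> {set T}) :
    special V F -> (forall e, e \in F -> phi e :&: V = e :&: V) ->
  special V (phi @: F).
Proof.
move=> [F0 Vdeg Fdeg Finj] phiV.
have phi_inj : {in F &, injective phi}.
  by move=> a b aF bF eab; apply: Finj => //; rewrite -(phiV a) // -(phiV b) // eab.
have memV e v : e \in F -> v \in V -> (v \in phi e) = (v \in e).
  by move=> eF vV; have /setP/(_ v) := phiV e eF; rewrite !inE vV !andbT.
split.
- by rewrite imset_eq0.
- move=> v vV; rewrite -(Vdeg v vV) -[RHS](card_in_imset (f := phi)); last first.
    by move=> a b /setIdP[aF _] /setIdP[bF _]; apply: phi_inj.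
  congr #|pred_of_set _|; apply/setP=> e; rewrite inE; apply/andP/imsetP.
    case=> /imsetP[a aF ->]; rewrite memV // => va.
    by exists a => //; apply/setIdP.
  by case=> a /setIdP[aF va] ->; rewrite imset_f // memV.
- by move=> _ /imsetP[e eF ->]; rewrite phiV // Fdeg.
- by move=> _ _ /imsetP[a aF ->] /imsetP[b bF ->]; rewrite !phiV // => /Finj->.
Qed.

(** Edges are lifted by restoring contracted vertices. Each vertex of [V] lies in an edge of the
    minor, so [V] avoids [X2] and traces do not change. *)
Lemma minor_no_special (T : finType) (C : {set {set T}}) (X1 X2 : {set T}) :
  no_special C -> no_special (minor_edges C X1 X2).
Proof.
move=> nsC V F sF sVF.
pose lift (e : {set T}) := odflt e [pick E in C | E :\: X2 == e].
have liftP e : e \in F -> lift e \in C /\ lift e :\: X2 = e.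
  move/(subsetP sF)/minor_edgesP=> [E [EC _ eE]]; rewrite /lift.
  case: pickP => [E' /andP[E'C /eqP E'e] //|/(_ E)].
  by rewrite EC eE eqxx.
apply: (nsC V (lift @: F)).
  by apply/subsetP=> _ /imsetP[e /liftP[] + _ ->].
apply: special_transport => // e eF; have [_ le] := liftP e eF.
rewrite -{2}le; apply/setP=> v; rewrite !inE.
case vV: (v \in V); rewrite ?andbF // !andbT.
suff -> : v \notin X2 by [].
case: sVF => _ /(_ v vV) Vdeg _ _.
have /card_gt0P[f] : 0 < #|[set e in F | v \in e]| by rewrite Vdeg.
by case/setIdP=> /liftP[_ <-]; rewrite inE => /andP[].
Qed.

(** A vertex of [L] outside the branch [G] lies in no other edge; one exists by the antichain
    condition. *)
Lemma leaf_free_vertex (T : finType) (C : {set {set T}}) (L : {set T}) :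
    set0 \notin C -> antichain C -> leaf_in C L ->
  exists v, exists! E : {set T}, E \in C /\ v \in E.
Proof.
move=> C0 acC [LC [CL|[G [GC nGL Lmax]]]].
  have /set0Pn[v vL] : L != set0 by apply: contraNneq C0 => <-.
  by exists v, L; split=> // E [+ _]; rewrite CL => /set1P.
have /subsetPn[v vL vG] : ~~ (L \subset G).
  by apply/negP=> /(acC L G LC GC) LG; apply: nGL.
exists v, L; split=> // E [EC vE]; apply/eqP; rewrite eq_sym; apply: contraNT vG.
by move/eqP=> nEL; have /subsetP/(_ v) := Lmax E EC nEL; rewrite !inE vL vE => /(_ isT).
Qed.

Definition combinatorial_fvp (T : finType) (C : {set {set T}}) : Prop :=
  forall X1 X2 : {set T}, [disjoint X1 & X2] ->
    minor_edges C X1 X2 != set0 -> set0 \notin minor_edges C X1 X2 ->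
    exists2 v, v \in ~: (X1 :|: X2) &
      exists! E : {set T}, E \in minimal_sets (minor_edges C X1 X2) /\ v \in E.

Lemma minimal_antichain (T : finType) (A : {set {set T}}) :
  antichain (minimal_sets A).
Proof.
by move=> E F /minimal_setsP[EA _] /minimal_setsP[_ minF] EF; apply: minF.
Qed.

Lemma no_special_fvp (T : finType) (C : {set {set T}}) :
  no_special C -> combinatorial_fvp C.
Proof.
move=> nsC X1 X2 _ /set0Pn[E EM] M0.
have [L leafL] : exists L, leaf_in (minimal_sets (minor_edges C X1 X2)) L.
  apply: no_special_leaf; last first.
    apply: no_specialS (minor_no_special nsC); exact: minimal_sub.
  by have [B Bmin _] := minimal_exists EM; apply/set0Pn; exists B.
have [] := leaf_free_vertex _ (@minimal_antichain _ _) leafL.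
  by apply: contra M0; apply: (subsetP (minimal_sub _)).
move=> v [E' [[E'M vE'] uniqE']]; exists v; last by exists E'.
have /minor_edgesP[D [_ DX1 E'D]] := subsetP (minimal_sub _) _ E'M.
move: vE'; rewrite E'D !inE => /andP[vX2 vD].
by rewrite negb_or vX2 andbT (disjointFr DX1 vD).
Qed.

Lemma fvp_no_special_minor (T : finType) (C : {set {set T}}) (k : nat)
    (X1 X2 V : {set T}) (F : {set {set T}}) :
    combinatorial_fvp C -> [disjoint X1 & X2] -> #|~: (X1 :|: X2)| = k ->
    F \subset minimal_sets (minor_edges C X1 X2) -> ~ special V F.
Proof.
move=> fvpC; elim/ltn_ind: k X1 X2 F => k IHk X1 X2 F dis12 cardY sF sVF.
have [/set0Pn[e0 e0F] Vdeg Fdeg Finj] := sVF.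
have FM e : e \in F -> e \in minor_edges C X1 X2.
  by move=> eF; apply: (subsetP (minimal_sub _)); apply: (subsetP sF).
have Fmin e : e \in F -> forall B, B \in minor_edges C X1 X2 -> B \subset e -> B = e.
  by move/(subsetP sF)/minimal_setsP=> [].
have [|||v vY [E [[Emin vE] Euniq]]] := fvpC X1 X2; rewrite //.
- by apply/set0Pn; exists e0; apply: FM.
- apply/negP=> M0; have := Fdeg e0 e0F.
  by rewrite -(Fmin e0 e0F set0) ?sub0set // set0I cards0.
(* A vertex of [V] lies in two edges of [F], a free vertex in only one minimal edge. *)
have vV : v \notin V.
  apply/negP=> /Vdeg/eqP/cards2P[a [b [nab eab]]]; case/eqP: nab.
  have /setIdP[aF va] : a \in [set e in F | v \in e] by rewrite eab set21.
  have /setIdP[bF vb] : b \in [set e in F | v \in e] by rewrite eab set22.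
  have <- : E = a by apply: Euniq; split=> //; apply: (subsetP sF).
  by apply: Euniq; split=> //; apply: (subsetP sF).
move: vY; rewrite !inE negb_or => /andP[vX1 vX2].
have smaller (Y : {set T}) : v \notin Y -> #|~: (v |: Y)| < #|~: Y|.
  move=> vY; apply: proper_card; rewrite properC properE subsetUr.
  by apply/subsetPn; exists v; rewrite ?setU11.
have vY : v \notin X1 :|: X2 by rewrite inE negb_or vX1.
(* If [E] is outside [F], no edge of [F] contains [v]. Deleting [v] only removes edges, so those of
   [F] survive and stay minimal. *)
case: (boolP (E \in F)) => EF; last first.
  have noV e : e \in F -> v \notin e.
    move=> eF; apply: contraNN EF => ve.
    by rewrite (Euniq e) //; split=> //; apply: (subsetP sF).
  apply: (IHk #|~: (v |: X1 :|: X2)| _ (v |: X1) X2 F) => //.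
  - by rewrite -cardY -setUA; apply: smaller.
  - by rewrite disjoint_setU1 vX2.
  apply/subsetP=> e eF; have /minor_edgesP[D [DC DX1 eD]] := FM e eF.
  apply/minimal_setsP; split.
    apply/minor_edgesP; exists D; split=> //.
    rewrite disjoint_sym disjoint_setU1 disjoint_sym DX1 andbT.
    by have := noV e eF; rewrite eD inE vX2.
  move=> B /minor_edgesP[D' [D'C D'X1 ->]]; apply: Fmin => //.
  apply/minor_edgesP; exists D'; split=> //.
  by move: D'X1; rewrite disjoint_sym disjoint_setU1 disjoint_sym => /andP[].
(* If [E] is in [F], contracting [v] preserves the traces; minimality of the contracted edges
   remains to be checked. *)
have phiV e : (e :\ v) :&: V = e :&: V.
  apply/setP=> x; rewrite !inE; case: eqP => // ->.
  by rewrite (negbTE vV) !andbF.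
apply: (IHk #|~: (X1 :|: (v |: X2))| _ X1 (v |: X2) ((fun e => e :\ v) @: F)) => //.
- by rewrite -cardY setUCA; apply: smaller.
- by rewrite disjoint_sym disjoint_setU1 vX1 disjoint_sym.
- apply/subsetP=> _ /imsetP[e eF ->].
  have M'P f : reflect (exists2 f0, f0 \in minor_edges C X1 X2 & f = f0 :\ v)
                       (f \in minor_edges C X1 (v |: X2)).
    apply: (iffP (minor_edgesP _ _ _ _)) => [[D [DC DX1 ->]]|[f0]].
      exists (D :\: X2); first by apply/minor_edgesP; exists D.
      by rewrite setDDl setUC.
    case/minor_edgesP=> D [DC DX1 ->] ->; exists D; split=> //.
    by rewrite setDDl setUC.
  apply/minimal_setsP; split; first by apply/M'P; exists e; rewrite ?FM.
  move=> _ /M'P[f fM ->] fe; apply/eqP; rewrite eqEsubset fe /=.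
  (* If [f0] avoids [v], it lies in [e] and equals it by minimality. Otherwise [f0 = E], whose trace
     is then contained in that of [e]; both have two elements, so [e = E]. *)
  have [f0 f0min f0f] := minimal_exists fM.
  have f0M := subsetP (minimal_sub _) _ f0min.
  apply: subset_trans (setSD _ f0f).
  case: (boolP (v \in f0)) => vf0; last first.
    have vf0e : f0 \subset e.
      apply: subset_trans (subsetDl e [set v]); apply: subset_trans fe.
      by rewrite subsetD1 f0f.
    by rewrite -(Fmin e eF f0 f0M vf0e).
  have f0E : E = f0 by apply: Euniq.
  suff -> : e = E by rewrite f0E.
  apply: Finj => //; apply/esym/eqP; rewrite eqEcard !Fdeg // leqnn andbT.
  rewrite -phiV -[e :&: V]phiV; apply: setSI; apply: subset_trans fe.
  by rewrite f0E; apply: setSD.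
- exact: special_transport.
Qed.

Lemma minor_edges00 (T : finType) (C : {set {set T}}) :
  minor_edges C set0 set0 = C.
Proof.
apply/setP=> e; apply/minor_edgesP/idP => [[E [EC _ ->]]|eC].
  by rewrite setD0.
by exists e; rewrite setD0 -setI_eq0 setI0.
Qed.

(** [C] is its own minor for empty [X1] and [X2], and all its edges are minimal. *)
Lemma fvp_no_special (T : finType) (C : {set {set T}}) :
  antichain C -> combinatorial_fvp C -> no_special C.
Proof.
move=> acC fvpC V F sFC; apply: (@fvp_no_special_minor _ C _ set0 set0) => //.
  by rewrite -setI_eq0 setI0.
rewrite minor_edges00; apply: subset_trans sFC _; apply/subsetP=> E EC.
by apply/minimal_setsP; split=> // B BC; apply: acC.
Qed.

(** * Monomial ideals and the minors of the edge ideal *)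

Local Open Scope ring_scope.

Lemma gen_ideal0 (R : comNzRingType) (G : R -> Prop) : gen_ideal G 0.
Proof. by exists [::]; split=> //; rewrite big_nil. Qed.

Lemma gen_idealD (R : comNzRingType) (G : R -> Prop) (p q : R) :
  gen_ideal G p -> gen_ideal G q -> gen_ideal G (p + q).
Proof.
move=> [s [sG ->]] [t [tG ->]]; exists (s ++ t); split; last by rewrite big_cat.
by move=> c; rewrite mem_cat => /orP[/sG|/tG].
Qed.

Lemma gen_idealMl (R : comNzRingType) (G : R -> Prop) (c p : R) :
  gen_ideal G p -> gen_ideal G (c * p).
Proof.
move=> [s [sG ->]]; exists [seq (c * x.1, x.2) | x <- s]; split.
  by move=> _ /mapP[x /sG ? ->].
by rewrite big_map mulr_sumr; apply: eq_bigr => x _; rewrite mulrA.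
Qed.

Lemma gen_ideal_mem (R : comNzRingType) (G : R -> Prop) (g : R) :
  G g -> gen_ideal G g.
Proof.
move=> Gg; exists [:: (1, g)]; split; last by rewrite big_seq1 mul1r.
by move=> c; rewrite inE => /eqP->.
Qed.

Lemma gen_ideal_ind (R : comNzRingType) (G P : R -> Prop) :
    P 0 -> (forall p q, P p -> P q -> P (p + q)) ->
    (forall c g, G g -> P (c * g)) ->
  forall p, gen_ideal G p -> P p.
Proof.
move=> P0 PD PG _ [s [sG ->]]; elim: s sG => [|c s IHs] sG.
  by rewrite big_nil.
rewrite big_cons; apply: PD; first by apply/PG/sG; rewrite mem_head.
by apply: IHs => x xs; apply: sG; rewrite inE xs orbT.
Qed.

Lemma gen_ideal_sub (R : comNzRingType) (G1 G2 : R -> Prop) :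
  (forall g, G1 g -> gen_ideal G2 g) -> forall p, gen_ideal G1 p -> gen_ideal G2 p.
Proof.
move=> G12; apply: gen_ideal_ind; first exact: gen_ideal0.
  by move=> p q; apply: gen_idealD.
by move=> c g /G12; apply: gen_idealMl.
Qed.

Definition mon_ideal (K : fieldType) n (U : 'X_{1..n} -> Prop) :
    {mpoly K[n]} -> Prop :=
  gen_ideal (fun q => exists2 u : 'X_{1..n}, U u & q = 'X_[u]).

Lemma mon_ideal_msupp (K : fieldType) n (U : 'X_{1..n} -> Prop)
    (p : {mpoly K[n]}) : mon_ideal U p ->
  forall w, w \in msupp p -> exists2 u, U u & (u <= w)%MM.
Proof.
apply: (gen_ideal_ind (P := fun p : {mpoly K[n]} =>
  forall w, w \in msupp p -> exists2 u, U u & (u <= w)%MM)).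
- by move=> w; rewrite msupp0.
- by move=> q r Hq Hr w /msuppD_le; rewrite mem_cat => /orP[/Hq|/Hr].
- move=> c _ [u Uu ->] w; rewrite (perm_mem (msuppMX _ _)) => /mapP[w' _ ->].
  by exists u; rewrite // lem_addr.
Qed.

Lemma mon_idealX (K : fieldType) n (U : 'X_{1..n} -> Prop) (w : 'X_{1..n}) :
  mon_ideal U ('X_[w] : {mpoly K[n]}) <-> exists2 u, U u & (u <= w)%MM.
Proof.
split=> [/mon_ideal_msupp|[u Uu uw]]; first by apply; rewrite msuppX inE.
by rewrite -(submK uw) mpolyXD; apply/gen_idealMl/gen_ideal_mem; exists u.
Qed.

(** Each [u] in [U] is divisible by a member of any generating subset, which the antichain condition
    identifies with [u]. *)
Lemma min_mon_gens_antichain (K : fieldType) n (U : 'X_{1..n} -> Prop)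
    (J : {mpoly K[n]} -> Prop) :
    (forall u u', U u -> U u' -> (u <= u')%MM -> u = u') ->
  mon_generates U J -> min_mon_gens U J.
Proof.
move=> acU genU; split=> // G' G'U genG' u Uu.
have /genG'/mon_idealX[u' G'u' u'u] : J 'X_[u].
  by apply/genU/mon_idealX; exists u; rewrite ?lepm_refl.
by rewrite -(acU u' u (G'U _ G'u') Uu u'u).
Qed.

(** Each [u] in [U] is divisible by some [g] in [G], and [g] by some [u'] in [U]; then [u' = u = g].
    Hence [U] is contained in [G], and minimality of [G] gives equality. *)
Lemma min_mon_gens_unique (K : fieldType) n (U G : 'X_{1..n} -> Prop)
    (J : {mpoly K[n]} -> Prop) :
    (forall u u', U u -> U u' -> (u <= u')%MM -> u = u') ->
  mon_generates U J -> min_mon_gens G J -> forall u, G u <-> U u.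
Proof.
move=> acU genU [genG minG].
have UG u : U u -> G u.
  move=> Uu; have /genG/mon_idealX[g Gg gu] : J 'X_[u].
    by apply/genU/mon_idealX; exists u; rewrite ?lepm_refl.
  have /genU/mon_idealX[u' Uu' u'g] : J 'X_[g].
    by apply/genG/mon_idealX; exists g; rewrite ?lepm_refl.
  have ug : (u <= g)%MM by rewrite -(acU u' u Uu' Uu (lepm_trans u'g gu)).
  suff -> : u = g by [].
  by apply/mnmP=> i; apply/eqP; rewrite eqn_leq (mnm_lepP ug) (mnm_lepP gu).
by move=> u; split; [apply: minG|apply: UG].
Qed.

(** * Squarefree generators of the minors of the edge ideal *)

Definition edge_mnm n (Y e : {set 'I_n}) : 'X_{1..#|Y|} :=
  [multinom nat_of_bool (enum_val j \in e) | j < #|Y|].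

Lemma edge_mnm_le n (Y e e' : {set 'I_n}) : e \subset Y ->
  (edge_mnm Y e <= edge_mnm Y e')%MM = (e \subset e').
Proof.
move=> /subsetP eY; apply/mnm_lepP/subsetP => [le x xe|ee' j].
  have := le (enum_rank_in (eY x xe) x); rewrite !mnmE enum_rankK_in ?eY // xe.
  by case: (x \in e').
by rewrite !mnmE; case xe: (_ \in e) => //; rewrite ee'.
Qed.

Lemma edge_mnm_free n (Y e : {set 'I_n}) (i : 'I_#|Y|) :
  (U_(i) <= edge_mnm Y e)%MM = (enum_val i \in e).
Proof. by rewrite lep1mP mnmE; case: (_ \in e). Qed.

Lemma minor_edges_sub (T : finType) (C : {set {set T}}) (X1 X2 e : {set T}) :
  e \in minor_edges C X1 X2 -> e \subset ~: (X1 :|: X2).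
Proof.
case/minor_edgesP=> E [_ EX1 ->]; apply/subsetP=> x; rewrite !inE negb_or.
by case/andP=> -> xE; rewrite (disjointFr EX1 xE).
Qed.

Definition edge_mnms n (Y : {set 'I_n}) (A : {set {set 'I_n}}) :
    'X_{1..#|Y|} -> Prop :=
  fun u => exists2 e, e \in A & u = edge_mnm Y e.

Arguments edge_mnms {n} Y A _.

Lemma minor_subst_out (K : fieldType) n (X1 X2 : {set 'I_n}) (i : 'I_n) :
    i \notin X1 -> i \notin ~: (X1 :|: X2) -> minor_subst K X1 X2 i = 1.
Proof.
move=> /negbTE iX1 iY; rewrite /minor_subst iX1.
by case: pickP => // j /eqP ji; rewrite -ji enum_valP in iY.
Qed.

Lemma minor_subst_val (K : fieldType) n (X1 X2 : {set 'I_n})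
    (j : 'I_#|~: (X1 :|: X2)|) :
  minor_subst K X1 X2 (enum_val j) = 'X_j.
Proof.
have := enum_valP j; rewrite !inE negb_or => /andP[/negbTE jX1 _].
rewrite /minor_subst jX1; case: pickP => [j' /eqP/enum_val_inj->//|/(_ j)].
by rewrite eqxx.
Qed.

(** A vertex of [E] in [X1] gives a zero factor; otherwise the vertices in [X2] give factors 1. *)
Lemma edge_minor_subst (K : fieldType) n (X1 X2 E : {set 'I_n}) :
  (\prod_(i in E) 'X_i) \mPo [tuple minor_subst K X1 X2 i | i < n] =
  if [disjoint E & X1] then 'X_[edge_mnm (~: (X1 :|: X2)) (E :\: X2)] else 0.
Proof.
rewrite rmorph_prod /=.
under eq_bigr => i _ do rewrite comp_mpolyXU -tnth_nth tnth_mktuple.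
case: ifPn => [EX1|]; last first.
  rewrite disjoints_subset => /subsetPn[x xE]; rewrite inE negbK => xX1.
  by rewrite (bigD1 x) //= {1}/minor_subst xX1 mul0r.
set Y := ~: _.
have -> : \prod_(i in E) minor_subst K X1 X2 i
        = \prod_(i in Y | i \in E) minor_subst K X1 X2 i.
  rewrite (bigID (fun i => i \in Y)) /= [X in _ * X]big1 ?mulr1; last first.
    by move=> i /andP[iE iY]; apply: minor_subst_out; rewrite ?(disjointFr EX1 iE).
  by apply: eq_bigl => i; rewrite andbC.
rewrite big_enum_val_cond /= mpolyXE_id big_mkcond /=; apply: eq_bigr => j _.
rewrite minor_subst_val mnmE in_setD.
have := enum_valP j; rewrite !inE negb_or => /andP[_ ->] /=.
by case: (_ \in E).
Qed.

(** Renaming the variables back is a section of the substitution, so coefficients over the minor can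
    be lifted. *)
Lemma minor_subst_section (K : fieldType) n (X1 X2 : {set 'I_n})
    (Y := ~: (X1 :|: X2)) (q : {mpoly K[#|Y|]}) :
  (q \mPo [tuple 'X_(enum_val j) | j < #|Y|])
    \mPo [tuple minor_subst K X1 X2 i | i < n] = q.
Proof.
rewrite [X in comp_mpoly _ X]comp_mpolyE raddf_sum /= [RHS]mpolyE; apply: eq_bigr => m _.
rewrite comp_mpolyZ rmorph_prod mpolyXE_id; congr (_ *: _).
apply: eq_bigr => j _; rewrite rmorphXn /= tnth_mktuple comp_mpolyXU.
by rewrite -tnth_nth tnth_mktuple minor_subst_val.
Qed.

(** The substitution is a surjective ring morphism, so the image of the edge ideal is generated by
    the images of its generators. *)
Lemma minor_generates (K : fieldType) n (C : {set {set 'I_n}})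
    (X1 X2 : {set 'I_n}) :
  mon_generates (edge_mnms (~: (X1 :|: X2)) (minor_edges C X1 X2))
                (minor (edge_ideal K C) X1 X2).
Proof.
move=> q; split=> [[p Ip ->]|].
  move: p Ip; apply: gen_ideal_ind.
  - by rewrite comp_mpoly0; apply: gen_ideal0.
  - by move=> p p' Hp Hp'; rewrite comp_mpolyD; apply: gen_idealD.
  - move=> c _ [E EC ->]; rewrite rmorphM /=; apply: gen_idealMl.
    rewrite edge_minor_subst; case: ifP => EX1; last exact: gen_ideal0.
    apply: gen_ideal_mem; exists (edge_mnm (~: (X1 :|: X2)) (E :\: X2)) => //.
    by exists (E :\: X2) => //; apply/minor_edgesP; exists E.
move: q; apply: gen_ideal_ind.
- by exists 0; rewrite ?comp_mpoly0 //; apply: gen_ideal0.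
- move=> _ _ [p Ip ->] [p' Ip' ->]; exists (p + p'); last by rewrite comp_mpolyD.
  exact: gen_idealD.
- move=> c _ [_ [_ /minor_edgesP[E [EC EX1 ->]] ->] ->].
  exists ((c \mPo [tuple 'X_(enum_val j) | j < _]) * \prod_(i in E) 'X_i).
    by apply/gen_idealMl/gen_ideal_mem; exists E.
  by rewrite rmorphM /= edge_minor_subst EX1 minor_subst_section.
Qed.

Lemma minor_generates_minimal (K : fieldType) n (C : {set {set 'I_n}})
    (X1 X2 : {set 'I_n}) :
  mon_generates
    (edge_mnms (~: (X1 :|: X2)) (minimal_sets (minor_edges C X1 X2)))
    (minor (edge_ideal K C) X1 X2).
Proof.
move=> q; rewrite (@minor_generates K n C X1 X2 q); split; apply: gen_ideal_sub.
  move=> _ [_ [e eM ->] ->]; have [e0 e0M e0e] := minimal_exists eM.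
  apply/mon_idealX; exists (edge_mnm (~: (X1 :|: X2)) e0); first by exists e0.
  by rewrite edge_mnm_le // (subset_trans e0e) ?(minor_edges_sub eM).
move=> _ [_ [e eM ->] ->]; apply: gen_ideal_mem.
exists (edge_mnm (~: (X1 :|: X2)) e) => //.
by exists e => //; apply: (subsetP (minimal_sub _)).
Qed.

(** The minimal edges form an antichain, so their monomials are the only minimal generating set,
    whichever [G] is chosen in [free_variable]. *)
Lemma free_variable_minor (K : fieldType) n (C : {set {set 'I_n}})
    (X1 X2 : {set 'I_n}) (i : 'I_#|~: (X1 :|: X2)|) :
  free_variable (minor (edge_ideal K C) X1 X2) i <->
  exists! e : {set 'I_n},
    e \in minimal_sets (minor_edges C X1 X2) /\ enum_val i \in e.
Proof.
set M := minimal_sets _; set Y := ~: _ in i *.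
have MY e : e \in M -> e \subset Y.
  by move/(subsetP (minimal_sub _))/minor_edges_sub.
have acU u u' : edge_mnms Y M u -> edge_mnms Y M u' -> (u <= u')%MM -> u = u'.
  move=> [e eM ->] [e' e'M ->]; rewrite edge_mnm_le ?MY // => ee'.
  by rewrite (minimal_antichain eM e'M ee').
have mnm_inj e e' : e \in M -> e' \in M -> edge_mnm Y e = edge_mnm Y e' -> e = e'.
  move=> eM e'M eq; apply: (minimal_antichain eM e'M).
  by rewrite -(edge_mnm_le _ (MY e eM)) eq lepm_refl.
have genU := @minor_generates_minimal K n C X1 X2.
split=> [[G minG [u [[Gu iu] uniq_u]]]|[e [[eM ie] uniq_e]]].
  have GE := min_mon_gens_unique acU genU minG.
  have [e eM ue] := (GE u).1 Gu; exists e; split.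
    by split=> //; rewrite -edge_mnm_free -ue.
  move=> e' [e'M ie']; apply: mnm_inj => //; rewrite -ue; apply: uniq_u.
  by rewrite edge_mnm_free; split=> //; apply/GE; exists e'.
exists (edge_mnms Y M); first exact: min_mon_gens_antichain.
exists (edge_mnm Y e); split; first by rewrite edge_mnm_free; split=> //; exists e.
move=> _ [[e' e'M ->]]; rewrite edge_mnm_free => ie'.
by rewrite (uniq_e e').
Qed.

Lemma minor_is_zero (K : fieldType) n (C : {set {set 'I_n}})
    (X1 X2 : {set 'I_n}) :
  (forall q, minor (edge_ideal K C) X1 X2 q <-> q = 0) <->
  minor_edges C X1 X2 = set0.
Proof.
split=> [J0|M0 q].
  apply/setP=> e; rewrite inE; apply/negP=> eM.
  have /J0/eqP : minor (edge_ideal K C) X1 X2 'X_[edge_mnm (~: (X1 :|: X2)) e].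
    apply/(@minor_generates K n C X1 X2)/gen_ideal_mem.
    by exists (edge_mnm (~: (X1 :|: X2)) e) => //; exists e.
  by rewrite -msupp_eq0 msuppX.
rewrite (@minor_generates K n C X1 X2 q) M0; split=> [|->]; last exact: gen_ideal0.
by case=> -[|c s] [sG ->]; [rewrite big_nil|have [u [e + _]] := sG c (mem_head c s); rewrite inE].
Qed.

Lemma minor_is_unit (K : fieldType) n (C : {set {set 'I_n}})
    (X1 X2 : {set 'I_n}) :
  minor (edge_ideal K C) X1 X2 1 <-> set0 \in minor_edges C X1 X2.
Proof.
rewrite (@minor_generates K n C X1 X2 1) -mpolyX0; split=> [/mon_idealX|M0].
  case=> _ [e eM ->] e0; suff <- : e = set0 by [].
  apply/eqP; rewrite -subset0 -(edge_mnm_le _ (minor_edges_sub eM)).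
  apply/mnm_lepP=> j; apply: leq_trans (mnm_lepP e0 j) _.
  by rewrite mnm0E.
apply/mon_idealX; exists (edge_mnm (~: (X1 :|: X2)) set0); first by exists set0.
by apply/mnm_lepP=> j; rewrite mnmE inE.
Qed.

(** The zero ideal corresponds to a minor without edges, the unit ideal to one with an empty edge.
    In particular the property does not depend on [K]. *)
Lemma free_vertex_propertyP (K : fieldType) n (C : {set {set 'I_n}}) :
  free_vertex_property K C <-> combinatorial_fvp C.
Proof.
split=> fvp X1 X2 dis12.
  move=> /eqP nM0 /negP M0; have [||i] := fvp X1 X2 dis12.
  - by move/minor_is_zero.
  - by move/minor_is_unit.
  by move/free_variable_minor=> free; exists (enum_val i); first exact: enum_valP.
move=> J J0 J1; have [||v vY free] := fvp X1 X2 dis12.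
- by apply/eqP=> /minor_is_zero-/(_ K).
- by apply/negP=> /minor_is_unit-/(_ K).
exists (enum_rank_in vY v); apply/free_variable_minor.
by rewrite enum_rankK_in.
Qed.

Theorem corollary3p10 (K : fieldType) (n : nat) (C : {set {set 'I_n}})
    (HC : clutter C) :
  (forest C <-> totally_balanced C) /\
  (totally_balanced C <-> free_vertex_property K C).
Proof.
have [_ acC] := HC; split.
  split; first by move/(forest_no_special HC)/totally_balancedP.
  by move/totally_balancedP/(no_special_forest HC).
split; first by move/totally_balancedP/no_special_fvp/free_vertex_propertyP.
by move/free_vertex_propertyP/(fvp_no_special acC)/totally_balancedP.
Qed.
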